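(* Let $\{\eta(u),\mathbf{q}(u)\}$ be an entropy pair for the flux function $\mathbf{f}$ and let $v(u)=\eta'(u)$ be the corresponding entropy variable. Suppose that $u_h=u_h(\cdot,t)\in V_h$ satisfies the semi-discrete continuous Galerkin scheme $$\sum_{e=1}^{E_h}\int_{K^e} w_h\left(\frac{\partial u_h}{\partial t}+\nabla\cdot \mathbf{f}(u_h)\right)\,\mathrm{d}\mathbf{x}=0\qquad \forall w_h\in V_h .$$ Then $$\sum_{e=1}^{E_h}\int_{K^e}\left(\frac{\partial \eta(u_h)}{\partial t}+\nabla\cdot\mathbf{q}(u_h)\right)\mathrm{d}\mathbf{x}=\sum_{e=1}^{E_h}\int_{K^e}(v(u_h)-v_h)\left(\frac{\partial u_h}{\partial t}+\nabla\cdot\mathbf{f}(u_h)\right)\mathrm{d}\mathbf{x}\qquad\forall v_h\in V_h .$$ In particular, this identity holds for $v_h\equiv 0$ and for an arbitrary approximation $v_h\in V_h$ to $v(u_h)$.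
   Context: The scalar conservation law is $\frac{\partial u}{\partial t}+\nabla\cdot\mathbf{f}(u)=0$ in $\mathbb{R}^d\times\mathbb{R}_+$, $d\in\{1,2,3\}$, with a possibly nonlinear flux function $\mathbf{f}=(\mathsf{f}_1,\ldots,\mathsf{f}_d)$. Let $\mathcal G\subset\mathbb{R}$ be a convex set (an invariant set of the initial value problem, i.e. the exact solution stays in $\mathcal G$). A convex function $\eta:\mathcal G\to\mathbb{R}$ is called an entropy, and $v(u)=\eta'(u)$ the entropy variable, if there is an entropy flux $\mathbf{q}:\mathcal G\to\mathbb{R}^d$ with $v(u)\mathbf{f}'(u)=\mathbf{q}'(u)$; the pair $\{\eta,\mathbf{q}\}$ is then called an entropy pair. The functions $\mathbf{f},\eta,\mathbf{q}$ are differentiable enough for the expressions to make sense, and $u_h$ takes values in $\mathcal G$. Discretization: $\mathcal T_h=\{K^1,\ldots,K^{E_h}\}$ is a conforming mesh of a bounded domain in $\mathbb{R}^d$, with $\bar\Omega_h=\bigcup_{e=1}^{E_h}K^e$; periodic boundary conditions are assumed. For $p\in\mathbb{N}$, $V_h^e\in\{\mathbb{P}_p(K^e),\mathbb{Q}_p(K^e)\}$ is the local polynomial space on $K^e$, and $V_h=\{v_h\in C(\bar\Omega_h): v_h|_{K^e}\in V_h^e,\ e=1,\ldots,E_h\}$ is the space of continuous piecewise-polynomial functions. The function $u_h(\cdot,t)\in V_h$ is differentiable in time, and all statements are for each fixed $t$. *)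

(* Defs.v *)
From HB Require Import structures.
From mathcomp Require Import all_boot all_order all_algebra.
From mathcomp Require Import all_classical all_reals all_analysis.

Set Implicit Arguments.
Unset Strict Implicit.
Unset Printing Implicit Defensive.

Import Order.TTheory GRing.Theory Num.Theory.
Import numFieldNormedType.Exports.

Local Open Scope classical_set_scope.
Local Open Scope ring_scope.

(* Lebesgue measure on R^n, as the iterated product of the one-dimensional
   Lebesgue measure; it is characterized by [lebesgue_measure_box] below. *)

Section cons_measure.
Context (R : realType) (n : nat).
Let T := measurableTypeR R.
Variable m : {sigma_finite_measure set (n.-tuple T) -> \bar R}.

Definition cons_pair (z : T * n.-tuple T) : n.+1.-tuple T := [tuple of z.1 :: z.2].

Lemma measurable_cons_pair : measurable_fun setT cons_pair.
Proof. exact: measurable_cons. Qed.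

Definition cons_measure : set (n.+1.-tuple T) -> \bar R :=
  pushforward (lebesgue_measure \x m)%E cons_pair.

Let cons_measure0 : cons_measure set0 = 0%E.
Proof. by rewrite /cons_measure /pushforward preimage_set0 measure0. Qed.

Let cons_measure_ge0 A : (0 <= cons_measure A)%E.
Proof. by rewrite /cons_measure /pushforward; exact: measure_ge0. Qed.

Let cons_measure_sigma_additive : semi_sigma_additive cons_measure.
Proof.
move=> F mF tF mUF; rewrite /cons_measure /pushforward preimage_bigcup.
apply: measure_semi_sigma_additive.
- by move=> k; rewrite -[X in measurable X]setTI; exact: measurable_cons_pair.
- apply/trivIsetP => /= i j _ _ ij; rewrite -preimage_setI.
  by move/trivIsetP : tF => /(_ _ _ _ _ ij) ->//; rewrite preimage_set0.
- rewrite -preimage_bigcup -[X in measurable X]setTI.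
  exact: measurable_cons_pair.
Qed.

HB.instance Definition _ := isMeasure.Build _ _ _ cons_measure
  cons_measure0 cons_measure_ge0 cons_measure_sigma_additive.

Let uncons (t : n.+1.-tuple T) : T * n.-tuple T := (thead t, [tuple of behead t]).

Let measurable_uncons : measurable_fun setT uncons.
Proof.
apply: measurable_fun_pair; last exact: measurable_behead.
exact: measurable_tnth.
Qed.

Let cons_pairK : cancel cons_pair uncons.
Proof. by case=> a t; congr pair; apply/val_inj. Qed.

Let cons_measure_sigma_finite : sigma_finite setT cons_measure.
Proof.
have /sigma_finiteP[F [TF ndF Foo]] := sigma_finiteT (@lebesgue_measure R).
have /sigma_finiteP[G [TG ndG Goo]] := sigma_finiteT m.
exists (fun k => uncons @^-1` (F k `*` G k)).
  apply/seteqP; split=> // t _.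
  have [i _ Fi] : (\bigcup_i F i) (uncons t).1 by rewrite -TF.
  have [j _ Gj] : (\bigcup_j G j) (uncons t).2 by rewrite -TG.
  exists (maxn i j) => //; split.
  - by move: Fi; exact/subsetPset/ndF/leq_maxl.
  - by move: Gj; exact/subsetPset/ndG/leq_maxr.
move=> k; have [mF Fk] := Foo k; have [mG Gk] := Goo k; split.
  by rewrite -[X in measurable X]setTI; apply: measurable_uncons => //; exact: measurableX.
rewrite /cons_measure /pushforward -comp_preimage.
rewrite (_ : uncons \o cons_pair = id) ?preimage_id; last first.
  by apply/funext => z; exact: cons_pairK.
by rewrite product_measure1E// lte_mul_pinfty// ge0_fin_numE.
Qed.

HB.instance Definition _ := Measure_isSigmaFinite.Build _ _ _ cons_measure
  cons_measure_sigma_finite.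

End cons_measure.

Fixpoint lebesgue_measureRn (R : realType) (n : nat) :
    {sigma_finite_measure set (n.-tuple (measurableTypeR R)) -> \bar R} :=
  match n with
  | 0 => \d_([tuple] : 0.-tuple (measurableTypeR R))
  | n'.+1 => cons_measure (lebesgue_measureRn R n')
  end.

Lemma lebesgue_measure_box (R : realType) (n : nat) (A : 'I_n -> set (measurableTypeR R)) :
  (forall i, measurable (A i)) ->
  (lebesgue_measureRn R n [set t | forall i, A i (tnth t i)] =
   \prod_(i < n) lebesgue_measure (A i))%E.
Proof.
elim: n A => [A _|n IH A mA] /=.
  rewrite big_ord0 diracE/= mem_set//=; by case.
have mB : measurable [set t : n.-tuple (measurableTypeR R) |
    forall i, A (lift ord0 i) (tnth t i)].
  rewrite (_ : mkset _ = \bigcap_(i in [set: 'I_n])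
      ((fun t => tnth t i) @^-1` A (lift ord0 i))); last first.
    by apply/seteqP; split=> t /= At i; [move=> _|]; exact: At.
  apply: fin_bigcap_measurable; first exact: finite_finset.
  by move=> i _; rewrite -[X in measurable X]setTI; exact: measurable_tnth.
rewrite big_ord_recl -IH//= -product_measure1E// /cons_measure /pushforward.
congr (product_measure1 _ _ _); apply/seteqP; split=> -[a t] /=.
- move=> At; split; first by have := At ord0.
  by move=> i; have := At (lift ord0 i); rewrite tnthS.
- move=> [Aa At] i; case: (unliftP ord0 i) => [j|] ->; last by [].
  by rewrite tnthS; exact: At.
Qed.


Section Euclidean.
Context (R : realType) (d : nat).
Implicit Types (K F : set 'rV[R]_d) (v : 'rV[R]_d -> R).

Definition point (t : d.-tuple (measurableTypeR R)) : 'rV[R]_d :=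
  \row_i tnth t i.

Definition integral_over K v : R :=
  \int[lebesgue_measureRn R d]_(t in point @^-1` K) v (point t).

Definition divergence (F : 'I_d -> 'rV[R]_d -> R) (x : 'rV[R]_d) : R :=
  \sum_(i < d) 'D_('e_i) (F i) x.

(* Half-space representation; the interior is required to be nonempty, so the
   polytope is full-dimensional. *)
Definition convex_polytope K : Prop :=
  [/\ bounded_set K, interior K !=set0 &
      exists m (A : 'M[R]_(m, d)) (b : 'cV[R]_m),
        K = [set x : 'rV[R]_d | forall i, (A *m x^T) i 0 <= b i 0]].

(* The empty set and K itself are faces of K. *)
Definition face K F : Prop :=
  [/\ F `<=` K, convex_set F &
      forall x y (l : R), K x -> K y -> 0 < l < 1 ->
        F (l *: x + (1 - l) *: y) -> F x /\ F y].

Definition conforming_mesh (Omega : set 'rV[R]_d) (E : nat)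
    (K : 'I_E -> set 'rV[R]_d) : Prop :=
  [/\ forall e, convex_polytope (K e),
      injective K,
      forall e e', face (K e) (K e `&` K e') &
      closure Omega = \bigcup_(e in [set: 'I_E]) K e].

Definition bounded_domain (Omega : set 'rV[R]_d) : Prop :=
  [/\ open Omega, connected Omega, Omega !=set0 & bounded_set Omega].

Definition monomial (p : nat) (m : {ffun 'I_d -> 'I_p.+1}) (x : 'rV[R]_d) : R :=
  \prod_(i < d) x 0 i ^+ m i.

Definition polyP (p : nat) v : Prop :=
  exists c : {ffun 'I_d -> 'I_p.+1} -> R,
    v = fun x => \sum_(m : {ffun 'I_d -> 'I_p.+1} | (\sum_i m i <= p)%N)
                    c m * monomial m x.

Definition polyQ (p : nat) v : Prop :=
  exists c : {ffun 'I_d -> 'I_p.+1} -> R,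
    v = fun x => \sum_m c m * monomial m x.

(* Unlike P_p, the space Q_p depends on the choice of axes: [Qspace A] uses
   the linear coordinates x *m A.  A = 1 gives the polynomials of degree at most
   p in each Cartesian variable; for a parallelepiped, A can be chosen to give
   the image of Q_p of the reference cube under the affine element map. *)
Inductive local_space := Pspace | Qspace of 'M[R]_d.

Definition admissible (S : local_space) : Prop :=
  if S is Qspace A then A \in unitmx else True.

Definition in_local_space (p : nat) (S : local_space) K v : Prop :=
  match S with
  | Pspace => exists2 g, polyP p g & {in K, v =1 g}
  | Qspace A => exists2 g, polyQ p g & {in K, forall x, v x = g (x *m A)}
  end.

(* Periodic boundary conditions with set of periods [Per]: boundary points that
   differ by a period are identified.  [Per = set0] imposes no identification. *)
Definition periodic_on (Omega Per : set 'rV[R]_d) v : Prop :=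
  forall x z, Per z -> (closure Omega `\` Omega) x ->
    (closure Omega `\` Omega) (x + z) -> v (x + z) = v x.

(* Members of the finite element space are represented by total functions; only
   their values on [closure Omega] are constrained. *)
Definition fe_space (Omega Per : set 'rV[R]_d) (E : nat) (K : 'I_E -> set 'rV[R]_d)
    (S : 'I_E -> local_space) (p : nat) v : Prop :=
  [/\ {within closure Omega, continuous v}, periodic_on Omega Per v &
      forall e, in_local_space p (S e) (K e) v].

End Euclidean.

Arguments Pspace {R d}.

(* Derivatives relative to a subset of the real line, so that they are one-sided
   at the endpoints of an interval. *)
Section Within.
Context {R : realType}.
Implicit Types (A : set R) (g : R -> R) (x : R).

Definition quotient_within A g x : set_system R :=
  (fun y => (g y - g x) / (y - x)) @ within A x^'.

Definition derivable_within A g x : Prop := cvg (quotient_within A g x).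

Definition derive_within A g x : R := lim (quotient_within A g x).

Definition C1_within A g : Prop :=
  (forall x, A x -> derivable_within A g x) /\
  {within A, continuous (derive_within A g)}.

End Within.

Section Entropy.
Context (R : realType) (d : nat).
Implicit Types (G : set R) (f q : 'I_d -> R -> R) (eta : R -> R).

Definition entropy_variable G eta : R -> R := derive_within G eta.

Definition entropy_pair G f eta q : Prop :=
  [/\ convex_function (E := R^o) G eta,
      forall u, G u -> derivable_within G eta u &
      forall i u, G u -> derivable_within G (q i) u /\
        entropy_variable G eta u * derive_within G (f i) u =
        derive_within G (q i) u].

End Entropy.

Section Scheme.
Context (R : realType) (d : nat).
Implicit Types (u : R -> 'rV[R]_d -> R).

Definition dt u (t : R) (x : 'rV[R]_d) : R :=
  derive_within `[0, +oo[ (u^~ x) t.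

Definition div_comp (f : 'I_d -> R -> R) (w : 'rV[R]_d -> R) :
    'rV[R]_d -> R :=
  divergence (fun i => f i \o w).

Definition residual (f : 'I_d -> R -> R) u (t : R) (x : 'rV[R]_d) : R :=
  dt u t x + div_comp f (u t) x.

End Scheme.

(* Main.v *)
Require Import Defs.
From mathcomp Require Import all_boot all_order all_algebra.
From mathcomp Require Import all_classical all_reals all_analysis.
From mathcomp Require Import measurable_realfun ring.
Import Order.TTheory GRing.Theory Num.Theory.
Import numFieldNormedType.Exports.
Local Open Scope classical_set_scope.
Local Open Scope ring_scope.

Set Implicit Arguments.
Unset Strict Implicit.
Unset Printing Implicit Defensive.

(** Wherever [u] is smooth enough for the chain rule, the entropy residual is
    the residual of the conservation law times the entropy variable:
    d/dt eta(u) + div q(u) = v(u) du/dt + sum_i q_i'(u) d_i u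
    = v(u) (du/dt + div f(u)), because q_i' = v f_i'.  Integrating over the
    elements and subtracting the scheme tested with [vh], which contributes 0,
    gives the identity.  Two things have to be justified.

    Where the pointwise identity holds.  The divergence is made of two-sided
    partial derivatives, so its values on the boundary of an element depend on
    the behaviour of [u t] across the boundary and need not even be measurable
    there.  The identity is therefore proved in the interior of each element
    ([element_entropy_balance]); the boundary of a polytope lies in finitely
    many hyperplanes, which are null sets, and the Lebesgue integral of an
    arbitrary function is insensitive to its values on a measurable null set
    ([integral_over_interior]).

    Why the integral of (v(u) - vh) (du/dt + div f(u)) splits.  Both products
    have to be integrable.  The spatial terms are continuous functions of
    polynomials on a compact element.  For du/dt, only the pointwise existence
    of the time derivative is given, but a finite-dimensional function space
    has an interpolation formula u(s, x) = sum_i u(s, y_i) psi_i(x) with finitely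
    many nodes y_i and fixed polynomials psi_i ([local_space_interpolation]).
    Differentiating it in [s] shows that du/dt is a polynomial on the element. *)

(** * Integrals and null sets *)

Section negligible_sets.
Context (R : realType) (disp : measure_display) (T : measurableType disp).
Variable mu : {measure set T -> \bar R}.
Local Open Scope ereal_scope.
Import HBNNSimple.

(** For arbitrary functions, measurable or not: the integral of [f] is a supremum
    over simple functions below [f], and truncating a simple function to the
    complement of [N] puts it below [g] without changing its integral. *)
Lemma ge0_le_integral_off_null (N : set T) (f g : T -> \bar R) :
  measurable N -> mu N = 0 ->
  (forall x, 0 <= f x) -> (forall x, 0 <= g x) ->
  (forall x, ~ N x -> f x <= g x) ->
  \int[mu]_x f x <= \int[mu]_x g x.
Proof.
move=> mN N0 f0 g0 fg; rewrite !ge0_integralTE//.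
apply: ge_ereal_sup => _ [h /= hf <-]; apply: le_ereal_sup_tmp.
have [k kE] : exists k : {nnsfun T >-> R},
    forall x, k x = (if x \in N then 0 else h x)%R.
  exists (proj_nnsfun h (measurableC mN)) => x.
  rewrite /= /mindic indicE in_setC.
  by case: (x \in N) => /=; rewrite ?mulr0 ?mulr1.
exists (sintegral mu k).
  exists k => // x; rewrite kE; case: ifPn => [_|]; first exact: g0.
  rewrite notin_setE => Nx; exact: le_trans (hf x) (fg x Nx).
rewrite -!integralT_nnsfun (ae_eq_integral (fun x => (k x)%:E))//.
- exact/measurable_EFinP.
- exact/measurable_EFinP.
- exists N; split=> // x /= /not_implyP[_]; apply: contra_notP => Nx.
  by rewrite kE memNset.
Qed.

Lemma integral_off_null (N : set T) (f g : T -> \bar R) :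
  measurable N -> mu N = 0 -> (forall x, ~ N x -> f x = g x) ->
  \int[mu]_x f x = \int[mu]_x g x.
Proof.
have ge0_eq (a b : T -> \bar R) : measurable N -> mu N = 0 ->
    (forall x, 0 <= a x) -> (forall x, 0 <= b x) ->
    (forall x, ~ N x -> a x = b x) -> \int[mu]_x a x = \int[mu]_x b x.
  move=> mN N0 a0 b0 ab; apply/eqP; rewrite eq_le.
  by rewrite !(@ge0_le_integral_off_null N)// => x Nx; rewrite ab.
move=> mN N0 fg; rewrite (integralE _ _ f) (integralE _ _ g).
congr (_ - _); apply: ge0_eq => // x Nx.
  by rewrite !funeposE fg.
by rewrite !funenegE fg.
Qed.

Lemma Rintegral_off_null (D N : set T) (f g : T -> R) :
  measurable N -> mu N = 0 -> (forall x, D x -> ~ N x -> f x = g x) ->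
  (\int[mu]_(x in D) f x = \int[mu]_(x in D) g x)%R.
Proof.
move=> mN N0 fg; rewrite /Rintegral; congr fine.
rewrite integral_mkcond [RHS]integral_mkcond.
apply: (@integral_off_null N) => // x Nx; rewrite !patchE.
by case: ifPn => // /set_mem Dx; rewrite fg.
Qed.

End negligible_sets.

(** * Hyperplanes are null sets *)

Section hyperplanes.
Context (R : realType).

Lemma measurable_affine n (a : 'I_n -> R) :
  measurable_fun setT
    (fun t : n.-tuple (measurableTypeR R) => \sum_i a i * tnth t i : R).
Proof.
apply: measurable_sum => i; apply: measurable_funM => //.
exact: (@measurable_tnth _ (measurableTypeR R)).
Qed.

Lemma measurable_hyperplane n (a : 'I_n -> R) (b : R) :
  measurable [set t : n.-tuple (measurableTypeR R) |
              \sum_i a i * tnth t i = b].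
Proof.
rewrite -[X in measurable X]setTI.
exact: (@measurable_affine n a measurableT [set b] (measurable_set1 b)).
Qed.

(** Induction on the dimension, by slicing along the first coordinate.  If some
    other coefficient is nonzero, every slice is a hyperplane of the smaller
    space; otherwise the hyperplane is a product with a single point as first
    factor. *)
Lemma lebesgue_measureRn_hyperplane n (a : 'I_n -> R) (b : R) :
  (exists i, a i != 0) ->
  lebesgue_measureRn R n [set t | \sum_i a i * tnth t i = b] = 0%E.
Proof.
elim: n a b => [a b [[]//]|n IH a b [i ai0]] /=.
rewrite /cons_measure /pushforward.
have [[j aj0]|a'0] := pselect (exists j, a (lift ord0 j) != 0).
  rewrite /product_measure1; apply: integral0_eq => x _ /=.
  rewrite -[RHS](IH (fun j => a (lift ord0 j)) (b - a ord0 * x)).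
    2: by exists j.
  congr (lebesgue_measureRn R n _); rewrite xsectionE.
  apply/seteqP; split => t /=; rewrite big_ord_recl /= => tb.
    rewrite -tb addrC addKr; apply: eq_bigr => k _; by rewrite tnthS.
  rewrite -(subrK (a ord0 * x) b) -tb addrC; congr (_ + _).
  by apply: eq_bigr => k _; rewrite tnthS.
have a'E j : a (lift ord0 j) = 0.
  by apply/eqP/negPn/negP => aj; apply: a'0; exists j.
have a00 : a ord0 != 0.
  by case: (unliftP ord0 i) ai0 => [j|] ->//; rewrite a'E eqxx.
rewrite (_ : _ @^-1` _ = [set b / a ord0] `*` setT).
  by rewrite product_measure1E//= lebesgue_measure_set1 mul0e.
have E (z : measurableTypeR R * n.-tuple (measurableTypeR R)) :
    \sum_i a i * tnth (cons_pair z) i = a ord0 * z.1.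
  rewrite big_ord_recl big1 ?addr0// => k _; by rewrite a'E mul0r.
apply/seteqP; split => z /=; rewrite E.
  by move=> <-; split => //; rewrite mulrAC mulfV// mul1r.
by move=> [-> _]; rewrite mulrCA mulfV// mulr1.
Qed.

End hyperplanes.

(** * Polynomial functions *)

Section polynomial_functions.
Context (R : realType) (d : nat).
Implicit Types (f g : 'rV[R]_d -> R).

(** Polynomial functions, generated inductively so that continuity,
    measurability and the existence of polynomial partial derivatives are
    proved by induction on the generation. *)
Inductive polyfun : ('rV[R]_d -> R) -> Prop :=
| polyfun_cst c : polyfun (fun=> c)
| polyfun_coord i : polyfun (fun x => x 0 i)
| polyfunD f g : polyfun f -> polyfun g -> polyfun (fun x => f x + g x)
| polyfunM f g : polyfun f -> polyfun g -> polyfun (fun x => f x * g x).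

Lemma polyfun_sum (I : Type) (s : seq I) (P : pred I) (F : I -> 'rV[R]_d -> R) :
  (forall i, polyfun (F i)) -> polyfun (fun x => \sum_(i <- s | P i) F i x).
Proof.
move=> pF; elim: s => [|i s IH].
  by under eq_fun do rewrite big_nil; exact: polyfun_cst.
under eq_fun do rewrite big_cons; case: (P i) => //.
exact: polyfunD.
Qed.

Lemma polyfun_prod (I : Type) (s : seq I) (F : I -> 'rV[R]_d -> R) :
  (forall i, polyfun (F i)) -> polyfun (fun x => \prod_(i <- s) F i x).
Proof.
move=> pF; elim: s => [|i s IH].
  by under eq_fun do rewrite big_nil; exact: polyfun_cst.
by under eq_fun do rewrite big_cons; exact: polyfunM.
Qed.

Lemma polyfun_scale c f : polyfun f -> polyfun (fun x => c * f x).
Proof. by apply: polyfunM; exact: polyfun_cst. Qed.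

Lemma polyfunX f n : polyfun f -> polyfun (fun x => f x ^+ n).
Proof.
move=> pf; elim: n => [|n IH]; first exact: polyfun_cst.
by under eq_fun do rewrite exprS; exact: polyfunM.
Qed.

Lemma polyfun_monomial p (m : {ffun 'I_d -> 'I_p.+1}) : polyfun (monomial m).
Proof. by apply: polyfun_prod => i; apply: polyfunX; exact: polyfun_coord. Qed.

Lemma polyfun_mulmx (A : 'M[R]_d) f : polyfun f -> polyfun (fun x => f (x *m A)).
Proof.
elim=> [c|i|{}f g _ IHf _ IHg|{}f g _ IHf _ IHg].
- exact: polyfun_cst.
- under eq_fun do rewrite mxE; apply: polyfun_sum => j.
  by apply: polyfunM; [exact: polyfun_coord|exact: polyfun_cst].
- exact: polyfunD.
- exact: polyfunM.
Qed.

Lemma polyfun_continuous f : polyfun f -> continuous f.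
Proof.
elim=> [c|i|{}f g _ IHf _ IHg|{}f g _ IHf _ IHg] x.
- exact: cst_continuous.
- exact: coord_continuous.
- exact: (cvgD (IHf x) (IHg x)).
- exact: (cvgM (IHf x) (IHg x)).
Qed.

Lemma polyfun_measurable f : polyfun f ->
  measurable_fun setT (f \o @Defs.point R d : _ -> measurableTypeR R).
Proof.
elim=> [c|i|{}f g _ IHf _ IHg|{}f g _ IHf _ IHg] /=.
- exact: measurable_cst.
- rewrite (_ : _ \o _ = fun t => tnth t i); first exact: measurable_tnth.
  by apply/funext => t /=; rewrite mxE.
- exact: measurable_funD.
- exact: measurable_funM.
Qed.

Lemma polyfun_derive f v : polyfun f ->
  exists2 g, polyfun g & forall x, is_derive x v f (g x).
Proof.
elim=> [c|i|{}f g pf [f' pf' df] pg [g' pg' dg]|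
        {}f g pf [f' pf' df] pg [g' pg' dg]].
- exists (fun=> 0); first exact: polyfun_cst.
  by move=> x; exact: is_derive_cst.
- exists (fun=> v 0 i); first exact: polyfun_cst.
  move=> x.
  have E : (fun h : R => h^-1 *:
      (((fun x : 'rV[R]_d => x 0 i : R) \o shift x) (h *: v) - x 0 i)) @ 0^'
      --> (v 0 i : R).
    apply: cvg_near_cst; near=> h => /=.
    rewrite !mxE addrK scalerA mulVf ?scale1r//.
    by near: h; exact: nbhs_dnbhs_neq.
  by apply: DeriveDef; [apply/cvg_ex; exists (v 0 i)|exact: cvg_lim].
- exists (fun x => f' x + g' x); first exact: polyfunD.
  by move=> x; have := df x; have := dg x => ? ?; exact: is_deriveD.
- exists (fun x => f x * g' x + g x * f' x).
    by apply: polyfunD; exact: polyfunM.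
  by move=> x; have := df x; have := dg x => ? ?; exact: is_deriveM.
Unshelve. all: by end_near. Qed.

(** On the span of finitely many polynomial functions, a function is
    recovered linearly from its values at finitely many nodes of [K].  The nodes
    are added one function at a time: if the interpolation error [r] of the new
    function [phi k] vanishes on [K], the old formula still works; otherwise any
    [z] in [K] with [r z != 0] is taken as a new node, with basis function
    [r / r z]. *)
Lemma polyfun_interpolation (K : set 'rV[R]_d) (I : Type) (s : seq I)
    (phi : I -> 'rV[R]_d -> R) : (forall i, polyfun (phi i)) ->
  exists n (y : nat -> 'rV[R]_d) (psi : nat -> 'rV[R]_d -> R),
    [/\ forall i, (i < n)%N -> K (y i), forall i, polyfun (psi i) &
     forall (c : I -> R) x, K x ->
       \sum_(j <- s) c j * phi j x =
       \sum_(i < n) (\sum_(j <- s) c j * phi j (y i)) * psi i x].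
Proof.
move=> pphi; elim: s => [|k s [n [y [psi [Ky ppsi yE]]]]].
  exists 0%N, (fun=> 0), (fun=> fun=> 0); split=> //.
    by move=> _; exact: polyfun_cst.
  by move=> c x _; rewrite big_nil big_ord0.
pose r x := phi k x - \sum_(i < n) phi k (y i) * psi i x.
have gE (c : I -> R) x : K x -> \sum_(j <- k :: s) c j * phi j x =
    \sum_(i < n) (\sum_(j <- k :: s) c j * phi j (y i)) * psi i x + c k * r x.
  move=> Kx; rewrite big_cons yE// /r mulrBr mulr_sumr.
  under [in RHS]eq_bigr do rewrite big_cons mulrDl -mulrA.
  rewrite big_split /=; ring.
have [[z [Kz rz]]|r0] := pselect (exists z, K z /\ r z != 0); last first.
  exists n, y, psi; split => // c x Kx; rewrite gE//.
  suff -> : r x = 0 by rewrite mulr0 addr0.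
  by apply/eqP/negPn/negP => rx; apply: r0; exists x.
have pr : polyfun (fun x => (r z)^-1 * r x).
  apply: polyfun_scale; apply: polyfunD => //.
  under eq_fun do rewrite -sumrN.
  apply: polyfun_sum => i.
  under eq_fun do rewrite -mulNr.
  exact: polyfun_scale.
(* The coefficient of r is determined by the value at z, so each old psi j is
   corrected by its own value at z. *)
exists n.+1, (fun i => if i is j.+1 then y j else z),
  (fun i => if i is j.+1 then (fun x => psi j x + - psi j z * ((r z)^-1 * r x))
            else (fun x => (r z)^-1 * r x)); split.
- by case=> [|i] //=; rewrite ltnS; exact: Ky.
- case=> [|i] //=; apply: polyfunD => //; exact: polyfun_scale.
- move=> c x Kx; rewrite big_ord_recl /= [LHS]gE//.
  under [X in _ = _ + X]eq_bigr do rewrite mulrDr mulNr mulrN [X in _ - X]mulrA.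
  rewrite sumrB -mulr_suml [in X in X * _ + _](gE c z Kz).
  by field.
Qed.

End polynomial_functions.

(** * Chain rules relative to a subset of the line *)

Section chain_rule.
Context (R : realType).

(** The chain rule for difference quotients along an arbitrary filter, the
    denominators being given by their inverses [a].  One form serves both the
    one-sided time derivative and the directional derivatives in space.  As in
    Caratheodory's proof, the outer quotient is completed by the derivative at
    [c], which also covers the case where [g] takes the value [c] again. *)
Lemma chain_rule_within (T : Type) (F : set_system T) {FF : Filter F}
    (B : set R) (h : R -> R) (g a : T -> R) (c l : R) :
  (\forall s \near F, B (g s)) -> g @ F --> c ->
  (fun s => (g s - c) * a s) @ F --> l -> derivable_within B h c ->
  (fun s => (h (g s) - h c) * a s) @ F --> derive_within B h c * l.
Proof.
move=> BF gc gl hc.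
pose phi y := if y == c then derive_within B h c else (h y - h c) / (y - c).
rewrite (_ : (fun s => _) = (fun s => phi (g s) * ((g s - c) * a s))); last first.
  apply/funext => s; rewrite /phi; case: eqVneq => [->|gsc].
    by rewrite !subrr !mul0r mulr0.
  by rewrite mulrA divfK// subr_eq0.
suff phig : phi \o g @ F --> derive_within B h c by exact: cvgM.
move=> U U1.
have : \forall y \near nbhs c, y != c -> B y -> U ((h y - h c) / (y - c)).
  exact: (hc U U1).
move=> /gc gU; suff : \forall s \near F, U (phi (g s)) by [].
have {}gU : \forall s \near F,
    g s != c -> B (g s) -> U ((h (g s) - h c) / (g s - c)) := gU.
apply: (filterS _ (filterI gU BF)) => s [/= H Bs].
rewrite /phi; case: eqVneq => [_|gsc]; first exact: nbhs_singleton.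
exact: H.
Qed.

Lemma within_nonneg_proper (t : R) : 0 <= t ->
  ProperFilter (within `[0, +oo[ t^').
Proof.
move=> t0; apply: Build_ProperFilter_ex => A tA.
suff /filter_ex : \forall s \near t^'+, A s by [].
have {}tA : \forall s \near t, s != t -> s \in `[0, +oo[ -> A s := tA.
apply: (filterS _ tA) => s H ts; apply: H; first by rewrite gt_eqF.
by rewrite in_itv/= andbT (le_trans t0)// ltW.
Qed.

Lemma derivable_within_cvg (A : set R) (g : R -> R) (x : R) :
  derivable_within A g x -> g @ within A x^' --> g x.
Proof.
move=> gx.
have xx : (fun s : R => s - x) @ within A x^' --> (0 : R).
  rewrite -(subrr x); apply: cvgB; last exact: cvg_cst.
  by apply: cvg_within_filter; apply: cvg_within_filter; exact: cvg_id.
have FF : Filter (within A x^') by exact: within_filter.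
have := cvgM gx xx; rewrite mulr0 => /(_ FF) g0.
have {}g0 : (fun s => g s - g x) @ within A x^' --> (0 : R).
  have E : \forall s \near within A x^',
      (g s - g x) / (s - x) * (s - x) = g s - g x.
    rewrite near_withinE; near=> s => _.
    have sx : s != x by near: s; exact: nbhs_dnbhs_neq.
    by rewrite divfK// subr_eq0.
  exact: (cvg_trans (near_eq_cvg E) g0).
rewrite -[X in _ --> X]addr0 -[X in X @ _]/(fun s => g s).
rewrite (_ : (fun s => g s) = (fun s => g x + (g s - g x))).
  by apply: cvgD => //; exact: cvg_cst.
by apply/funext => s; rewrite addrC subrK.
Unshelve. all: by end_near. Qed.

Lemma derive_within_comp (A B : set R) (g h : R -> R) (x : R) :
  ProperFilter (within A x^') -> (forall s, A s -> B (g s)) ->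
  derivable_within A g x -> derivable_within B h (g x) ->
  derive_within A (h \o g) x = derive_within B h (g x) * derive_within A g x.
Proof.
move=> Ax AB gx hgx; apply: cvg_lim => //=.
have FF : Filter (within A x^') by exact: within_filter.
have ABF : \forall s \near within A x^', B (g s).
  by rewrite near_withinE; apply: nearW => s; exact: AB.
exact: (chain_rule_within ABF (derivable_within_cvg gx) gx hgx).
Qed.

Lemma derive_within_sum (A : set R) (x : R) (n : nat) (F : 'I_n -> R -> R)
    (c : 'I_n -> R) :
  ProperFilter (within A x^') -> (forall i, derivable_within A (F i) x) ->
  derive_within A (fun s => \sum_i F i s * c i) x =
  \sum_i derive_within A (F i) x * c i.
Proof.
move=> Ax Fx; apply: cvg_lim => //=.
rewrite /quotient_within.
rewrite (_ : (fun y => _) =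
    fun y => \sum_i (F i y - F i x) / (y - x) * c i); last first.
  apply/funext => y; rewrite -sumrB mulr_suml; apply: eq_bigr => i _.
  by rewrite -mulrBl mulrAC.
apply: cvg_big => [|i _]; first exact: add_continuous.
by apply: cvgM; [exact: Fx|exact: cvg_cst].
Qed.

Lemma eq_derive_within (A : set R) (x : R) (g h : R -> R) :
  A x -> (forall s, A s -> g s = h s) ->
  derive_within A g x = derive_within A h x.
Proof.
have sub (a b : R -> R) : A x -> (forall s, A s -> a s = b s) ->
    quotient_within A a x `<=` quotient_within A b x.
  move=> Ax ab U aU.
  have {}aU : \forall s \near within A x^', U ((a s - a x) / (s - x)) := aU.
  suff : \forall s \near within A x^', U ((b s - b x) / (s - x)) by [].
  rewrite near_withinE in aU *; apply: (filterS _ aU) => s H As.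
  by have := H As; rewrite !ab.
move=> Ax gh; rewrite /derive_within; congr (lim _); apply/seteqP; split.
  exact: sub.
by apply: sub => // s As; rewrite gh.
Qed.

(** Near an interior point of [K] the function [w] agrees with the polynomial
    [P] and takes its values in [B], so a derivative of [g] relative to [B] is
    enough for a two-sided chain rule. *)
Lemma derive_comp_polyfun (d : nat) (K : set 'rV[R]_d) (B : set R)
    (w P : 'rV[R]_d -> R) (g : R -> R) (x v : 'rV[R]_d) (l : R) :
  polyfun P -> is_derive x v P l -> {in K, w =1 P} ->
  (forall y, K y -> B (w y)) -> interior K x ->
  derivable_within B g (w x) ->
  'D_v (g \o w) x = derive_within B g (w x) * l.
Proof.
move=> pP dP wP KB Kx gx.
have wPx : w x = P x by apply: wP; rewrite inE; exact: interior_subset.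
rewrite (near_eq_derive (g := g \o P)); last first.
  by apply: (filterS _ Kx) => y Ky /=; rewrite wP// inE.
have to_x : h *: v + x @[h --> (0 : R)] --> x.
  rewrite -[X in _ --> X]add0r -(scale0r v).
  by apply: cvgD; [apply: cvgZr_tmp; exact: cvg_id|exact: cvg_cst].
apply: cvg_lim => //=.
rewrite (_ : (fun h => _) =
    fun h : R => (g (P (h *: v + x)) - g (P x)) * h^-1); last first.
  by apply/funext => h /=; rewrite /GRing.scale /= mulrC.
have KF : \forall h \near (0 : R)^', B (P (h *: v + x)).
  have KF : \forall h \near (0 : R), K (h *: v + x) := to_x _ Kx.
  rewrite /dnbhs near_withinE; apply: (filterS _ KF) => h Kh _.
  by rewrite -wP ?inE//; exact: KB.
have PF : P (h *: v + x) @[h --> (0 : R)^'] --> P x.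
  by apply: cvg_within_filter; exact: (cvg_comp _ _ to_x (@polyfun_continuous _ _ _ pP x)).
have dPF : (P (h *: v + x) - P x) * h^-1 @[h --> (0 : R)^'] --> l.
  rewrite (_ : (fun h => _) = fun h => h^-1 *: ((P \o shift x) (h *: v) - P x)).
    by have [dPx <-] := dP; exact: dPx.
  by apply/funext => h /=; rewrite /GRing.scale /= mulrC.
by rewrite wPx in gx *; exact: (chain_rule_within KF PF dPF gx).
Qed.

End chain_rule.

(** * Polytopes *)

Section polytopes.
Context (R : realType) (d : nat).
Implicit Types (K : set 'rV[R]_d) (h : 'rV[R]_d -> R).

Let halfspace_fun m (A : 'M[R]_(m, d)) (i : 'I_m) (x : 'rV[R]_d) : R :=
  \sum_j A i j * x 0 j.

Let halfspace_funE m (A : 'M[R]_(m, d)) (i : 'I_m) (x : 'rV[R]_d) :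
  (A *m x^T) i 0 = halfspace_fun A i x.
Proof. by rewrite mxE; apply: eq_bigr => j _; rewrite mxE. Qed.

Let polyfun_halfspace m (A : 'M[R]_(m, d)) (i : 'I_m) :
  polyfun (halfspace_fun A i).
Proof. by apply: polyfun_sum => j; apply: polyfun_scale; exact: polyfun_coord. Qed.

Lemma polytope_compact K : convex_polytope K -> compact K.
Proof.
move=> [bK _ [m [A [b KE]]]]; apply: bounded_closed_compact => //.
rewrite (_ : K = \bigcap_(i in setT) (halfspace_fun A i @^-1` [set r | r <= b i 0])).
  apply: closed_bigI => i _; apply: preimage_closed; last exact: closed_le.
  by move=> x _; apply: polyfun_continuous.
rewrite KE; apply/seteqP; split => x /=.
  by move=> H i _ /=; rewrite -halfspace_funE.
by move=> H i; rewrite halfspace_funE; exact: H.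
Qed.

Lemma polytope_measurable K :
  convex_polytope K -> measurable (@Defs.point R d @^-1` K).
Proof.
move=> [_ _ [m [A [b KE]]]].
rewrite (_ : _ @^-1` _ = \bigcap_(i in [set: 'I_m])
    ((halfspace_fun A i \o @Defs.point R d) @^-1` [set r | r <= b i 0])).
  apply: fin_bigcap_measurable; first exact: finite_finset.
  move=> i _; rewrite -[X in measurable X]setTI.
  apply: (polyfun_measurable (polyfun_halfspace A i)) => //.
  by rewrite -set_itvNyc; exact: measurable_itv.
rewrite KE; apply/seteqP; split => x /=.
  by move=> H i _ /=; rewrite -halfspace_funE.
by move=> H i; rewrite halfspace_funE; exact: H.
Qed.

(** A bounded set lies in a cube, whose measure is a finite product of lengths. *)
Lemma polytope_finite_measure K : convex_polytope K ->
  (lebesgue_measureRn R d (@Defs.point R d @^-1` K) < +oo)%E.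
Proof.
move=> pK; have [[M [Mreal KM]] _ _] := pK.
pose I : set (measurableTypeR R) := `[- (M + 1), M + 1]%classic.
have mbox : measurable [set t : d.-tuple (measurableTypeR R) |
    forall i, I (tnth t i)].
  rewrite (_ : mkset _ = \bigcap_(i in [set: 'I_d])
      ((fun t : d.-tuple (measurableTypeR R) => tnth t i) @^-1` I)); last first.
    by apply/seteqP; split=> t /= At i; [move=> _|]; exact: At.
  apply: fin_bigcap_measurable; first exact: finite_finset.
  move=> i _; rewrite -[X in measurable X]setTI; apply: measurable_tnth => //.
  exact: measurable_itv.
apply: (@le_lt_trans _ _ (lebesgue_measureRn R d [set t | forall i, I (tnth t i)])).
  apply: le_measure; rewrite ?inE//; first exact: polytope_measurable.
  move=> t /= Kt i; have := KM (M + 1) _ _ Kt.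
  rewrite ltrDl ltr01 => /(_ isT); rewrite /I /= in_itv/= -ler_norml.
  apply: le_trans; rewrite [leRHS]/Num.norm /= mx_normrE.
  apply/bigmax_geP; right => /=; exists (0, i) => //=; by rewrite mxE.
rewrite (lebesgue_measure_box (A := fun=> I)); last by move=> i; exact: measurable_itv.
rewrite -ge0_fin_numE; last by apply: prode_ge0 => i _; exact: measure_ge0.
by apply: (big_ind (fun x => x \is a fin_num)) => // [x y|i _];
  [exact: fin_numM|rewrite /I lebesgue_measure_itv /=; case: ifP].
Qed.

(** A point of [K] off the hyperplanes where a defining inequality is an
    equality is an interior point. *)
Lemma integral_over_interior K (f g : 'rV[R]_d -> R) : convex_polytope K ->
  (forall x, interior K x -> f x = g x) -> integral_over K f = integral_over K g.
Proof.
move=> [_ _ [m [A [b KE]]]] fg.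
(* A zero row defines no hyperplane; its inequality holds everywhere as soon as
   K is nonempty. *)
pose nz i := exists j, A i j != 0.
pose H i := if `[< nz i >] then
  [set t : d.-tuple (measurableTypeR R) | \sum_j A i j * tnth t j = b i 0]
  else set0.
have mH i : measurable (H i).
  by rewrite /H; case: ifP => _ //; exact: measurable_hyperplane.
have H0 i : lebesgue_measureRn R d (H i) = 0%E.
  rewrite /H; case: ifPn => [/asboolP nzi|_]; last exact: measure0.
  exact: lebesgue_measureRn_hyperplane.
rewrite /integral_over.
apply: (@Rintegral_off_null _ _ _ _ _ (\big[setU/set0]_(i < m) H i)).
- exact: bigsetU_measurable.
- apply: measure_negligible; first exact: bigsetU_measurable.
  apply: big_ind => [|X Y|i _]; first exact: negligible_set0.
    by move=> nX nY; exact: (negligibleU nX nY).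
  exists (H i); split; [exact: mH|exact: H0|by []].
- move=> t /= Kt Ht; apply: fg.
  have strict i : nbhs (Defs.point t) [set y | (A *m y^T) i 0 <= b i 0].
    have Kti : halfspace_fun A i (Defs.point t) <= b i 0.
      by rewrite -halfspace_funE; move: Kt; rewrite KE.
    have [nzi|zi] := pselect (nz i); last first.
      apply: (filterS _ filterT) => y _; apply: le_trans Kti; rewrite halfspace_funE.
      rewrite /halfspace_fun !big1// => j _;
        suff -> : A i j = 0 by rewrite mul0r.
      + by apply/eqP/negPn/negP => Aij; apply: zi; exists j.
      + by apply/eqP/negPn/negP => Aij; apply: zi; exists j.
    have Kti' : halfspace_fun A i (Defs.point t) < b i 0.
      rewrite lt_neqAle Kti andbT; apply/eqP => ti; apply: Ht.
      rewrite (bigD1 i)//=; left; rewrite /H asboolT//= -ti.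
      by apply: eq_bigr => j _; rewrite mxE.
    have near_t : nbhs (Defs.point t) [set y | halfspace_fun A i y < b i 0] :=
      polyfun_continuous (polyfun_halfspace A i) (lt_nbhsl Kti').
    apply: (filterS _ near_t) => y /= /ltW.
    by rewrite halfspace_funE.
  rewrite KE; suff : nbhs (Defs.point t)
    [set y | forall i, (A *m y^T) i 0 <= b i 0] by [].
  exact: (@filter_forall _ _ (fun i => [set y | (A *m y^T) i 0 <= b i 0]) _ _ strict).
Qed.

End polytopes.

(** * Bounded measurable functions *)

Section bounded_measurable_functions.
Context (R : realType) (d : nat).
Implicit Types (K : set 'rV[R]_d) (h k P : 'rV[R]_d -> R).

(** Unlike integrability, boundedness together with measurability passes to
    products, and on a polytope it implies integrability. *)
Definition bounded_measurable K h : Prop :=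
  measurable_fun (@Defs.point R d @^-1` K)
    (h \o @Defs.point R d : _ -> measurableTypeR R) /\
  exists M, forall x, K x -> `|h x| <= M.

Lemma bounded_measurableD K h k :
  bounded_measurable K h -> bounded_measurable K k ->
  bounded_measurable K (fun x => h x + k x).
Proof.
move=> [mh [M hM]] [mk [N kN]]; split; first exact: measurable_funD.
exists (M + N) => x Kx; apply: le_trans (ler_normD _ _) _.
by rewrite lerD ?hM ?kN.
Qed.

Lemma bounded_measurableM K h k :
  bounded_measurable K h -> bounded_measurable K k ->
  bounded_measurable K (fun x => h x * k x).
Proof.
move=> [mh [M hM]] [mk [N kN]]; split; first exact: measurable_funM.
by exists (M * N) => x Kx; rewrite normrM ler_pM ?hM ?kN.
Qed.

Lemma compact_image_bounded (T : topologicalType) (D : set T) (g : T -> R) :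
  compact D -> {within D, continuous g} ->
  exists M, forall x, D x -> `|g x| <= M.
Proof.
move=> cD cg; have [M [_ gM]] := compact_bounded (continuous_compact cg cD).
exists (M + 1) => x Dx; apply: (gM (M + 1)); last by exists x.
by rewrite ltrDl.
Qed.

Lemma bounded_measurable_polyfun K P : compact K -> polyfun P -> bounded_measurable K P.
Proof.
move=> cK pP; split.
  by apply: (measurable_funS measurableT) => //; exact: polyfun_measurable.
apply: compact_image_bounded => //.
by apply: continuous_subspaceT; exact: polyfun_continuous.
Qed.

Lemma bounded_measurable_sum K (I : Type) (s : seq I) (F : I -> 'rV[R]_d -> R) : compact K ->
  (forall i, bounded_measurable K (F i)) -> bounded_measurable K (fun x => \sum_(i <- s) F i x).
Proof.
move=> cK tF; elim: s => [|i s IH].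
  by under eq_fun do rewrite big_nil; apply: bounded_measurable_polyfun => //; exact: polyfun_cst.
by under eq_fun do rewrite big_cons; exact: bounded_measurableD.
Qed.

Lemma bounded_measurable_eq K h k : (forall x, K x -> h x = k x) ->
  bounded_measurable K h -> bounded_measurable K k.
Proof.
move=> hk [mh [M hM]]; split.
  by apply: eq_measurable_fun mh => t /set_mem Kt /=; rewrite hk.
by exists M => x Kx; rewrite -hk// hM.
Qed.

Lemma bounded_measurable_comp K (G : set R) (g : R -> R) P : compact K -> is_interval G ->
  {within G, continuous g} -> polyfun P -> (forall x, K x -> G (P x)) ->
  bounded_measurable K (g \o P).
Proof.
move=> cK iG cg pP PG; split.
  apply: (@measurable_comp _ _ _ _ _ (measurableTypeR R) G g _ (P \o @Defs.point R d)).
  - exact: is_interval_measurable.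
  - by move=> _ [t Kt <-]; exact: PG.
  - by apply: subspace_continuous_measurable_fun => //; exact: is_interval_measurable.
  - by apply: (measurable_funS measurableT) => //; exact: polyfun_measurable.
have cPK : compact (P @` K).
  apply: continuous_compact => //.
  by apply: continuous_subspaceT; exact: polyfun_continuous.
have PKG : P @` K `<=` G by move=> _ [x Kx <-]; exact: PG.
have [M gM] := compact_image_bounded cPK (continuous_subspaceW PKG cg).
by exists M => x Kx; apply: gM; exists x.
Qed.

Lemma bounded_measurable_integrable K h : convex_polytope K -> bounded_measurable K h ->
  (lebesgue_measureRn R d).-integrable (@Defs.point R d @^-1` K)
    (EFin \o (h \o @Defs.point R d)).
Proof.
move=> pK [mh [M hM]]; apply: measurable_bounded_integrable => //.
- exact: polytope_measurable.
- exact: polytope_finite_measure.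
- exists M; split; first exact: num_real.
  by move=> N MN t /= Kt; apply: le_trans (hM _ Kt) (ltW MN).
Qed.

Lemma integral_overB K h k : convex_polytope K ->
  bounded_measurable K h -> bounded_measurable K k ->
  integral_over K (fun x => h x - k x) = integral_over K h - integral_over K k.
Proof.
move=> pK th tk; apply: RintegralB; first exact: polytope_measurable.
  exact: bounded_measurable_integrable.
exact: bounded_measurable_integrable.
Qed.

End bounded_measurable_functions.

(** * Local polynomial spaces *)

Section local_spaces.
Context (R : realType) (d : nat).

Lemma local_space_span (p : nat) (S : local_space R d) (K : set 'rV[R]_d) :
  exists2 phi : {ffun 'I_d -> 'I_p.+1} -> 'rV[R]_d -> R,
    forall m, polyfun (phi m) &
    forall w, in_local_space p S K w ->
      exists c : {ffun 'I_d -> 'I_p.+1} -> R, forall x, K x -> w x = \sum_m c m * phi m x.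
Proof.
case: S => [|A] /=.
  exists (@monomial R d p) => [m|w [_ [c ->] wE]]; first exact: polyfun_monomial.
  exists (fun m : {ffun 'I_d -> 'I_p.+1} => if (\sum_i m i <= p)%N then c m else 0) => x Kx.
  rewrite wE ?inE// big_mkcond; apply: eq_bigr => m _.
  by case: ifP => // _; rewrite mul0r.
exists (fun (m : {ffun 'I_d -> 'I_p.+1}) x => monomial m (x *m A)) => [m|w [_ [c ->] wE]].
  by apply: (@polyfun_mulmx _ _ A (monomial m)); exact: polyfun_monomial.
by exists c => x Kx; rewrite wE ?inE.
Qed.

Lemma local_space_interpolation (p : nat) (S : local_space R d) (K : set 'rV[R]_d) :
  exists n (y : nat -> 'rV[R]_d) (psi : nat -> 'rV[R]_d -> R),
    [/\ forall i, (i < n)%N -> K (y i), forall i, polyfun (psi i) &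
     forall w x, in_local_space p S K w -> K x ->
       w x = \sum_(i < n) w (y i) * psi i x].
Proof.
have [phi pphi wphi] := local_space_span p S K.
have [n [y [psi [Ky ppsi phiE]]]] := polyfun_interpolation K (index_enum _) pphi.
exists n, y, psi; split => // w x Sw Kx; have [c wE] := wphi w Sw.
rewrite wE// phiE//; apply: eq_bigr => i _; rewrite wE//; exact: Ky.
Qed.

Lemma in_local_space_polyfun (p : nat) (S : local_space R d) (K : set 'rV[R]_d) w :
  in_local_space p S K w -> exists2 P, polyfun P & {in K, w =1 P}.
Proof.
move=> Sw; have [n [y [psi [_ ppsi wE]]]] := local_space_interpolation p S K.
exists (fun x => \sum_(i < n) w (y i) * psi i x) => [|x /set_mem Kx]; last exact: wE.
by apply: polyfun_sum => i; apply: polyfun_scale.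
Qed.

End local_spaces.

(** * Entropy balance on one element *)

Section entropy_balance.
Context (R : realType) (d : nat).

Lemma convex_set_interval (G : set R) : convex_set (M := R^o) G -> is_interval G.
Proof.
move=> Gc x y Gx Gy z /andP[xz zy].
have [xy|xy] := eqVneq x y.
  by rewrite (_ : z = x)//; apply/eqP; rewrite eq_le xz andbT xy.
have yx0 : 0 < y - x by rewrite subr_gt0 lt_neqAle xy (le_trans xz).
have l0 : 0 <= (y - z) / (y - x) by rewrite divr_ge0 ?subr_ge0// (le_trans xz).
have l1 : (y - z) / (y - x) <= 1 by rewrite ler_pdivrMr// mul1r lerB.
have := Gc x y (Itv01 l0 l1) (mem_set Gx) (mem_set Gy).
move=> /set_mem; rewrite /conv /= /unstable.onem /GRing.scale /=.
rewrite [X in G X -> _](_ : _ = z)//.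
by field; rewrite subr_eq0 eq_sym.
Qed.

(** Besides the pointwise identity between the two residuals, this provides a
    bounded measurable function [rho] that equals the residual in the interior
    of [K], although the residual itself may be irregular on the boundary. *)
Lemma element_entropy_balance (G : set R) (f q : 'I_d -> R -> R) (eta : R -> R)
    (K : set 'rV[R]_d) (S : local_space R d) (p : nat)
    (u : R -> 'rV[R]_d -> R) (t : R) :
  compact K -> is_interval G -> (forall i, C1_within G (f i)) ->
  entropy_pair G f eta q -> 0 <= t ->
  (forall s, 0 <= s -> in_local_space p S K (u s)) ->
  (forall s x, 0 <= s -> K x -> G (u s x)) ->
  (forall x, K x -> derivable_within `[0, +oo[ (fun s => u s x) t) ->
  exists2 rho, bounded_measurable K rho & forall x, interior K x ->
    residual f u t x = rho x /\
    dt (fun s y => eta (u s y)) t x + div_comp q (u t) x =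
      entropy_variable G eta (u t x) * rho x.
Proof.
move=> cK iG fC1 [_ eta' q'] t0 uS uG ut.
have tF := within_nonneg_proper t0.
have [n [y [psi [Ky ppsi uE]]]] := local_space_interpolation p S K.
have [P pP uP] := in_local_space_polyfun (uS t t0).
have PG x : K x -> G (P x) by move=> Kx; rewrite -uP ?inE//; exact: uG.
have [dP dPE] : {dP : 'I_d -> 'rV[R]_d -> R & forall i, polyfun (dP i) /\
    forall x : 'rV[R]_d, is_derive x ('e_i : 'rV[R]_d) P (dP i x)}.
  apply: (@choice _ _ (fun i g => polyfun g /\
    forall x : 'rV[R]_d, is_derive x ('e_i : 'rV[R]_d) P (g x))) => i.
  have [g pg dg] := polyfun_derive ('e_i : 'rV[R]_d) pP.
  by exists g.
have div_compE (g : 'I_d -> R -> R) x : interior K x ->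
    (forall i, derivable_within G (g i) (u t x)) ->
    div_comp g (u t) x = \sum_i derive_within G (g i) (u t x) * dP i x.
  move=> Kx g'; apply: eq_bigr => i _.
  by apply: (derive_comp_polyfun pP ((dPE i).2 x) uP) => // z Kz; exact: uG.
exists (fun x => \sum_(i < n) dt u t (y i) * psi i x +
                 \sum_i (derive_within G (f i) \o P) x * dP i x).
  apply: bounded_measurableD; apply: bounded_measurable_sum => // i.
    by apply: bounded_measurable_polyfun => //; exact: polyfun_scale.
  apply: bounded_measurableM; last by apply: bounded_measurable_polyfun => //; exact: (dPE i).1.
  by apply: (@bounded_measurable_comp _ _ _ G) => //; exact: (fC1 i).2.
move=> x iKx; have Kx : K x := interior_subset iKx.
have Gux : G (u t x) by exact: uG.
have Ptx : P x = u t x by rewrite uP ?inE.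
have tA : `[0, +oo[%classic t by rewrite /= in_itv/= t0.
have dtE : dt u t x = \sum_(i < n) dt u t (y i) * psi i x.
  rewrite /dt (@eq_derive_within _ _ _ _ (fun s => \sum_(i < n) u s (y i) * psi i x)) //.
    apply: (derive_within_sum (F := fun (i : 'I_n) s => u s (y i))) => i.
    exact/ut/Ky.
  by move=> s /=; rewrite in_itv/= andbT => s0; apply: uE => //; exact: uS.
have etaE : dt (fun s y => eta (u s y)) t x =
    entropy_variable G eta (u t x) * dt u t x.
  have maps s : `[0, +oo[%classic s -> G (u s x).
    by rewrite /= in_itv/= andbT => s0; exact: uG.
  exact: (derive_within_comp tF maps (ut x Kx) (eta' _ Gux)).
have resE : residual f u t x = dt u t x +
    \sum_i derive_within G (f i) (u t x) * dP i x.
  by rewrite /residual div_compE// => i; exact: (fC1 i).1.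
have rhoE : residual f u t x = \sum_(i < n) dt u t (y i) * psi i x +
    \sum_i (derive_within G (f i) \o P) x * dP i x.
  by rewrite resE dtE /= Ptx.
split=> //; rewrite -rhoE resE etaE mulrDr; congr (_ + _).
rewrite div_compE => [|//|i]; last exact: (q' i _ Gux).1.
rewrite mulr_sumr; apply: eq_bigr => i _.
by rewrite mulrA (q' i _ Gux).2.
Qed.

End entropy_balance.

Section element_integrals.
Context (R : realType) (d : nat).

(** The entropy residual is the residual weighted by v(u), whose integral splits
    because both weighted residuals are integrable. *)
Lemma element_entropy_identity (G : set R) (f q : 'I_d -> R -> R) (eta : R -> R)
    (K : set 'rV[R]_d) (S : local_space R d) (p : nat)
    (u : R -> 'rV[R]_d -> R) (t : R) (vh : 'rV[R]_d -> R) :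
  convex_polytope K -> is_interval G -> (forall i, C1_within G (f i)) ->
  C1_within G eta -> entropy_pair G f eta q -> 0 <= t ->
  (forall s, 0 <= s -> in_local_space p S K (u s)) ->
  (forall s x, 0 <= s -> K x -> G (u s x)) ->
  (forall x, K x -> derivable_within `[0, +oo[ (fun s => u s x) t) ->
  in_local_space p S K vh ->
  integral_over K
    (fun x => (entropy_variable G eta (u t x) - vh x) * residual f u t x) =
  integral_over K
    (fun x => dt (fun s y => eta (u s y)) t x + div_comp q (u t) x) -
  integral_over K (fun x => vh x * residual f u t x).
Proof.
move=> pK iG fC1 etaC1 pair t0 uS uG ut Svh.
have cK := polytope_compact pK.
have [rho brho rhoE] := element_entropy_balance cK iG fC1 pair t0 uS uG ut.
have [P pP uP] := in_local_space_polyfun (uS t t0).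
have [V pV vhV] := in_local_space_polyfun Svh.
have bv : bounded_measurable K (fun x => entropy_variable G eta (u t x)).
  apply: (@bounded_measurable_eq _ _ _ (entropy_variable G eta \o P)).
    by move=> x Kx; rewrite /= uP ?inE.
  apply: (bounded_measurable_comp cK iG etaC1.2 pP) => x Kx.
  by rewrite -uP ?inE//; exact: uG.
have bvh : bounded_measurable K vh.
  apply: (@bounded_measurable_eq _ _ _ V); last exact: bounded_measurable_polyfun.
  by move=> x Kx; rewrite vhV ?inE.
rewrite (integral_over_interior pK (g := fun x =>
  entropy_variable G eta (u t x) * rho x - vh x * rho x)); last first.
  by move=> x Kx; rewrite (rhoE x Kx).1 mulrBl.
rewrite integral_overB//; [|exact: bounded_measurableM..].
congr (_ - _); apply: integral_over_interior => // x Kx.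
  by rewrite (rhoE x Kx).2.
by rewrite (rhoE x Kx).1.
Qed.

Lemma fe_space0 (Omega Per : set 'rV[R]_d) (E : nat) (K : 'I_E -> set 'rV[R]_d)
  (S : 'I_E -> local_space R d) (p : nat) : fe_space Omega Per K S p (fun=> 0).
Proof.
split => //.
  by apply: continuous_subspaceT => x; exact: cst_continuous.
move=> e; case: (S e) => [|A] /=; exists (fun=> 0) => //; exists (fun=> 0);
  by apply/funext => x; rewrite big1// => m _; rewrite mul0r.
Qed.

End element_integrals.

Unset Implicit Arguments.
Set Strict Implicit.
Set Printing Implicit Defensive.

Theorem theorem1 (R : realType) (d : nat) (d_range : (1 <= d <= 3)%N)
  (G : set R) (f : 'I_d -> R -> R) (eta : R -> R) (q : 'I_d -> R -> R)
  (Omega Per : set 'rV[R]_d) (E : nat) (K : 'I_E -> set 'rV[R]_d)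
  (S : 'I_E -> local_space R d) (p : nat)
  (u : R -> 'rV[R]_d -> R) (t : R)
  (G_convex : convex_set (M := R^o) G)
  (f_C1 : forall i, C1_within G (f i))
  (eta_C1 : C1_within G eta)
  (pair : entropy_pair G f eta q)
  (Omega_domain : bounded_domain Omega)
  (mesh : conforming_mesh Omega K)
  (S_admissible : forall e, admissible (S e))
  (t_ge0 : 0 <= t)
  (u_Vh : forall s, 0 <= s -> fe_space Omega Per K S p (u s))
  (u_G : forall s x, 0 <= s -> closure Omega x -> G (u s x))
  (u_dt : forall x, closure Omega x ->
     derivable_within `[0, +oo[ (fun s => u s x) t)
  (scheme : forall w, fe_space Omega Per K S p w ->
     \sum_(e < E) integral_over (K e) (fun x => w x * residual f u t x) = 0) :
  let v := entropy_variable G eta in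
  let identity (vh : 'rV[R]_d -> R) :=
    \sum_(e < E) integral_over (K e)
       (fun x => dt (fun s y => eta (u s y)) t x + div_comp q (u t) x) =
    \sum_(e < E) integral_over (K e)
       (fun x => (v (u t x) - vh x) * residual f u t x) in
  (forall vh, fe_space Omega Per K S p vh -> identity vh) /\
  identity (fun=> 0).
Proof.
move=> v identity.
have Kclosure e x : K e x -> closure Omega x.
  by case: mesh => _ _ _ ->; exists e.
have main vh : fe_space Omega Per K S p vh -> identity vh.
  move=> vhV; have [_ _ vhS] := vhV.
  rewrite /identity -[LHS]subr0 -[X in _ - X = _](scheme vh vhV) -sumrB.
  apply: eq_bigr => e _; apply/esym.
  apply: (@element_entropy_identity _ _ G f q eta _ (S e) p) => //.
  - by case: mesh.
  - exact: convex_set_interval.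
  - by move=> s s0; case: (u_Vh s s0).
  - by move=> s x s0 Kx; apply: u_G => //; exact: Kclosure Kx.
  - by move=> x Kx; apply: u_dt; exact: Kclosure Kx.
by split => //; apply: main; exact: fe_space0.
Qed.
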